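(* Let $\alpha\in\mathbb{N}$. For every $n\geq 2$, the $n$-point Gauss--Hermite quadrature $Q_n^{\mathrm{GH}}$ satisfies \[ e^{\mathrm{wor}}(Q_n^{\mathrm{GH}},\mathscr{H}_\alpha)\geq C_\alpha n^{-\alpha/2}, \] where $C_\alpha>0$ is a constant depending on $\alpha$ but independent of $n$.
   Context: Let $\rho(x)=\frac{1}{\sqrt{2\pi}}\mathrm{e}^{-x^2/2}$ and $L^2_\rho$ the space of (equivalence classes of) measurable $f:\mathbb{R}\to\mathbb{R}$ with $\|f\|_{L^2_\rho}^2=\int_\mathbb{R}|f(x)|^2\rho(x)\,\mathrm{d}x<\infty$. For $\alpha\in\mathbb{N}$, the weighted Sobolev space $\mathscr{H}_\alpha$ is the set of $f\in L^2_\rho$ having weak derivatives $f^{(\tau)}\in L^2_\rho$ for $\tau=1,\dots,\alpha$, with norm $\|f\|_\alpha=(\sum_{\tau=0}^\alpha\|f^{(\tau)}\|_{L^2_\rho}^2)^{1/2}$; elements are identified with their continuous representatives. Let $I(f)=\int_\mathbb{R}f(x)\rho(x)\,\mathrm{d}x$. For a quadrature rule $Q_n$, the worst-case error is $e^{\mathrm{wor}}(Q_n,\mathscr{H}_\alpha)=\sup_{0\neq f\in\mathscr{H}_\alpha}|I(f)-Q_n(f)|/\|f\|_\alpha$. The normalized probabilists' Hermite polynomial is $H_k(x)=\frac{(-1)^k}{\sqrt{k!}}\mathrm{e}^{x^2/2}\frac{\mathrm{d}^k}{\mathrm{d}x^k}\mathrm{e}^{-x^2/2}$. Gauss--Hermite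 quadrature is $Q_n^{\mathrm{GH}}(f)=\sum_{j=1}^n w_j f(\xi_j^{\mathrm{GH}})$, where $\xi_1^{\mathrm{GH}}<\dots<\xi_n^{\mathrm{GH}}$ are the zeros of $H_n$ and $w_j=1/[H_n'(\xi_j^{\mathrm{GH}})]^2$. *)

(* Defs.v *)
From HB Require Import structures.
From mathcomp Require Import all_boot all_order all_algebra.
From mathcomp Require Import all_classical all_reals all_analysis.
Set Implicit Arguments. Unset Strict Implicit. Unset Printing Implicit Defensive.
Import Order.TTheory GRing.Theory Num.Theory.
Import numFieldNormedType.Exports.
Local Open Scope classical_set_scope.
Local Open Scope ring_scope.

Section GH.
Variable R : realType.

Local Notation mu := (@lebesgue_measure R).

Definition rho (x : R) : R := expR (- (x ^+ 2) / 2) / Num.sqrt (2 * pi).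

Definition in_L2rho (f : R -> R) : Prop :=
  measurable_fun setT f /\
  (\int[mu]_x (((f x) ^+ 2 * rho x)%:E) < +oo)%E.

Definition L2rho_sq (f : R -> R) : R := fine (\int[mu]_x (((f x) ^+ 2 * rho x)%:E)).

Definition test_fun (phi : R -> R) : Prop :=
  (forall (k : nat) (x : R), derivable (derive1n k phi) x 1) /\
  exists M : R, forall x, M < `|x| -> phi x = 0.

Definition weak_deriv (tau : nat) (f g : R -> R) : Prop :=
  forall phi, test_fun phi ->
    Rintegral mu setT (fun x => f x * derive1n tau phi x) =
    (-1) ^+ tau * Rintegral mu setT (fun x => g x * phi x).

Definition sobolev_witness (alpha : nat) (f : R -> R) (g : nat -> R -> R) : Prop :=
  g 0%N = f /\
  (forall tau, (tau <= alpha)%N -> in_L2rho (g tau)) /\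
  (forall tau, (1 <= tau <= alpha)%N -> weak_deriv tau f (g tau)).

Definition sobolev_norm (alpha : nat) (g : nat -> R -> R) : R :=
  Num.sqrt (\sum_(tau < alpha.+1) L2rho_sq (g tau)).

Definition Igauss (f : R -> R) : R := Rintegral mu setT (fun x => f x * rho x).

(* normalized probabilists' Hermite polynomial via Rodrigues' formula *)
Definition hermite (k : nat) (x : R) : R :=
  (-1) ^+ k / Num.sqrt (k`!)%:R * expR (x ^+ 2 / 2) *
  derive1n k (fun y : R => expR (- (y ^+ 2) / 2)) x.

Definition QGH (n : nat) (f : R -> R) : R :=
  (\sum_(xi \in [set x | hermite n x = 0]) f xi / (derive1 (hermite n) xi) ^+ 2)%R.

(* worst-case error of Q on H_alpha (continuous representatives) *)
Definition ewor (alpha : nat) (Q : (R -> R) -> R) : \bar R :=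
  ereal_sup [set y : \bar R | exists (f : R -> R) (g : nat -> R -> R),
     [/\ continuous f, f <> (fun _ => 0), sobolev_witness alpha f g &
          y = (`|Igauss f - Q f| / sobolev_norm alpha g)%:E]].

End GH.

(* Main.v *)
Require Import Defs.
From HB Require Import structures.
From mathcomp Require Import all_boot all_order all_algebra.
From mathcomp Require Import all_classical all_reals all_analysis.
From mathcomp Require Import measurable_realfun ring lra zify.
Set Implicit Arguments. Unset Strict Implicit. Unset Printing Implicit Defensive.
Import Order.TTheory GRing.Theory Num.Theory.
Import numFieldNormedType.Exports.
Local Open Scope classical_set_scope.
Local Open Scope ring_scope.

(**
Let [q] be a multiple of [H_n].  The fooling function is [f = q^2 b^m], where
[b = max(0, 1 - x^2)] and [m = alpha + 3]: it vanishes at the nodes, so that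
[Q_n f = 0].  The equation [q'' = x q' - n q] gives [E' = 2 x q'^2] for the
energy [E = q'^2 + n q^2], hence [E(0) <= E <= e E(0)] on [[-1, 1]].  With the
normalisation [E(0) = n] the differential equation shows that each derivative
of [q] costs a factor [O(sqrt n)] on [[-1, 1]], so the Sobolev norm of [f] is
[O(n^(alpha/2))].  On the other hand [q'^2] and [n q^2] have the same weighted
mean up to [O(sqrt n)], while their sum is at least [n]; hence [I(f)] is bounded
below for large [n], and the finitely many remaining [n] only need [I(f) > 0].
*)

Lemma is_derive_mul (R : realType) (f g : R -> R) (x a b : R) :
  is_derive x 1 f a -> is_derive x 1 g b ->
  is_derive x 1 (fun y => f y * g y) (a * g x + f x * b).
Proof.
move=> fa gb; have := is_deriveM fa gb.
by rewrite /GRing.scale /= addrC [g x * a]mulrC.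
Qed.

(** * Hermite polynomials: recurrence, differential equation, normalisation *)

Section HermitePolynomials.
Variable R : realType.
Implicit Types (x : R) (n : nat).

(** These are the unnormalised probabilists' Hermite polynomials. The recurrence is, up to sign,
    what differentiating [he m] times the Gaussian produces, so it matches Rodrigues' formula
    directly. *)
Fixpoint he n : {poly R} :=
  if n is m.+1 then 'X * he m - (he m)^`() else 1.

(** The two facts feed each other: the first, inserted into the recurrence, gives the differential
    equation at the next index, and that equation turns the derivative of the next recurrence into
    the first fact again. *)
Lemma deriv_he_ode n :
  (he n.+1)^`() = n.+1%:R *: he n /\
  (he n)^`()^`() = 'X * (he n)^`() - n%:R *: he n.
Proof.
elim: n => [|n [IH1 IH2]].
  rewrite /= mulr1 -polyC1 derivC subr0 derivX linear0 mulr0 scale0r subr0.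
  by rewrite scale1r.
have ode : (he n.+1)^`()^`() = 'X * (he n.+1)^`() - n.+1%:R *: he n.+1.
  rewrite IH1 derivZ /= scalerBr scalerAr opprB addrC subrK //.
split=> //.
rewrite [he n.+2]/= derivB derivM derivX mul1r ode opprB.
by rewrite addrC addrACA addNr addr0 -[in RHS]natr1 scalerDl scale1r.
Qed.

Lemma he_ode n : (he n)^`()^`() = 'X * (he n)^`() - n%:R *: he n.
Proof. by case: (deriv_he_ode n). Qed.

Lemma deriv_he n : (he n.+1)^`() = n.+1%:R *: he n.
Proof. by case: (deriv_he_ode n). Qed.

(** At 0 the recurrence reads [He_(n+2)(0) = - (n+1) He_n(0)], so a nonzero value propagates in
    steps of two. *)
Lemma he_horner0_neq0 n : (he n).[0] != 0 \/ (he n.+1).[0] != 0.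
Proof.
elim: n => [|n [IH|IH]]; [by left; rewrite hornerE oner_eq0| |by left].
right; rewrite [he n.+2]/= deriv_he !hornerE /= oppr_eq0.
by rewrite mulf_neq0 // pnatr_eq0.
Qed.

Lemma is_derive_gauss x :
  is_derive x 1 (fun y : R => expR (- (y ^+ 2) / 2)) (- x * expR (- (x ^+ 2) / 2)).
Proof.
have D : is_derive x (1:R) (fun y : R => - (y ^+ 2) / 2) (- x).
  have -> : (fun y : R => - (y ^+ 2) / 2) = horner (- (1 / 2) *: 'X^2).
    apply/funext => y; rewrite !hornerE /=; by field.
  apply: is_derive_eq; rewrite derivZ derivXn !hornerE /=; by field.
rewrite mulrC; exact: (is_derive1_comp (f := expR)).
Qed.

Lemma derive1n_gauss n x :
  derive1n n (fun y : R => expR (- (y ^+ 2) / 2)) x =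
  (-1) ^+ n * (he n).[x] * expR (- (x ^+ 2) / 2).
Proof.
elim: n x => [|n IH] x; first by rewrite expr0 mul1r [he 0]/= hornerE mul1r.
rewrite derive1nS /=.
rewrite (_ : derive1n n _ = fun x => (-1) ^+ n * (he n).[x] * expR (- (x ^+ 2) / 2));
  last exact/funext.
have D := is_derive_mul (is_derive_mul (is_derive_cst ((-1) ^+ n : R) x 1)
  (is_derive_poly (he n) x)) (is_derive_gauss x).
rewrite derive1E (@derive_val _ _ _ _ _ _ _ D) !hornerE /= [(-1) ^+ n.+1]exprS; ring.
Qed.

Lemma hermiteE n x : hermite n x = (he n).[x] / Num.sqrt (n`!)%:R.
Proof.
rewrite /hermite derive1n_gauss.
have -> : (-1) ^+ n / Num.sqrt (n`!)%:R * expR (x ^+ 2 / 2) *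
  ((-1) ^+ n * (he n).[x] * expR (- x ^+ 2 / 2)) =
  ((-1) ^+ n * (-1) ^+ n) * (expR (x ^+ 2 / 2) * expR (- x ^+ 2 / 2)) *
   ((he n).[x] / Num.sqrt (n`!)%:R) by ring.
rewrite -expRD -exprD addnn -signr_odd odd_double.
by rewrite mulNr subrr expR0 !mul1r.
Qed.

Lemma hermite_eq0 n x : hermite n x = 0 -> (he n).[x] = 0.
Proof.
rewrite hermiteE => /eqP; rewrite mulf_eq0 invr_eq0 sqrtr_eq0 => /orP[/eqP //|].
by rewrite leNgt ltr0n fact_gt0.
Qed.

Definition he_energy n : R := (he n)^`().[0] ^+ 2 + n%:R * (he n).[0] ^+ 2.

(** Because [He_(n+1)'] is a multiple of [He_n], this energy combines the values at 0 of two
    consecutive polynomials, which never vanish together. This makes the normalisation in [he_unit]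
    legitimate. *)
Lemma he_energy_gt0 n : 0 < he_energy n.+1.
Proof.
rewrite /he_energy deriv_he hornerZ.
have h a : a != 0 :> R -> 0 < n.+1%:R * a ^+ 2.
  by move=> a0; rewrite mulr_gt0 ?ltr0Sn// exprn_even_gt0.
have g a : 0 <= n.+1%:R * a ^+ 2 :> R by rewrite mulr_ge0 ?ler0n// sqr_ge0.
case: (he_horner0_neq0 n) => H.
  by rewrite ltr_wpDr// exprMn expr2 -mulrA mulr_gt0 ?ltr0Sn// h.
by rewrite ltr_wpDl ?sqr_ge0// h.
Qed.

(* Normalised so that the energy [q'^2 + n q^2], [n = t.+1], equals [n] at 0. *)
Definition he_unit (t : nat) : {poly R} :=
  Num.sqrt (t.+1%:R / he_energy t.+1) *: he t.+1.

Lemma he_unit_ode t :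
  (he_unit t)^`()^`() = 'X * (he_unit t)^`() - t.+1%:R *: he_unit t.
Proof.
rewrite /he_unit !derivZ he_ode scalerBr -scalerAr; congr (_ - _).
by rewrite !scalerA mulrC.
Qed.

Lemma he_unit_energy0 t :
  (he_unit t)^`().[0] ^+ 2 + t.+1%:R * (he_unit t).[0] ^+ 2 = t.+1%:R.
Proof.
rewrite /he_unit derivZ !hornerZ; set s := Num.sqrt _.
transitivity (s ^+ 2 * he_energy t.+1); first by rewrite /he_energy; ring.
have e0 := he_energy_gt0 t.
by rewrite sqr_sqrtr ?divr_ge0 ?ler0n// ?divfK// ?gt_eqF// ltW.
Qed.

Lemma hermite_he_unit_eq0 t x : hermite t.+1 x = 0 -> (he_unit t).[x] = 0.
Proof. by move=> /hermite_eq0 H; rewrite /he_unit hornerZ H mulr0. Qed.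

End HermitePolynomials.

(** * Two-sided energy estimates from the differential equation *)

Section Energy.
Variable R : realType.
Implicit Types (x : R).

Lemma is_derive_continuous (f df : R -> R) :
  (forall x : R, is_derive x 1 f (df x)) -> continuous f.
Proof.
by move=> fdf x; apply/differentiable_continuous/derivable1_diffP; have [] := fdf x.
Qed.

(** The sign condition makes [f] decrease before 0 and increase after it; the mean value theorem is
    applied on the side where [x] lies. *)
Lemma is_derive_ge_at0 (f df : R -> R) x :
  (forall y : R, is_derive y 1 f (df y)) -> (forall y : R, 0 <= y * df y) -> f 0 <= f x.
Proof.
move=> fdf df0.
have cf a b : {within `[a, b], continuous f}.
  exact/continuous_subspaceT/(is_derive_continuous fdf).
have [x0|x0|<-] := ltgtP 0 x; rewrite // -subr_ge0.
- have [c] := MVT x0 (fun y _ => fdf y) (cf _ _).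
  rewrite in_itv /= => /andP[c0 _] ->; rewrite subr0.
  by rewrite mulr_ge0 ?(ltW x0)// -(pmulr_rge0 _ c0).
- have [c] := MVT x0 (fun y _ => fdf y) (cf _ _).
  rewrite in_itv /= => /andP[_ c0]; rewrite sub0r => H.
  rewrite -opprB oppr_ge0 H mulrN oppr_le0.
  by rewrite mulr_le0 ?(ltW x0)// -(nmulr_rge0 _ c0).
Qed.

Variables (q : {poly R}) (n : R).
Hypothesis n_gt0 : 0 < n.
Hypothesis q_ode : q^`()^`() = 'X * q^`() - n *: q.
Hypothesis q_energy0 : q^`().[0] ^+ 2 + n * q.[0] ^+ 2 = n.

Definition energy x : R := q^`().[x] ^+ 2 + n * q.[x] ^+ 2.

Lemma energy_derive x :
  is_derive x 1 energy (2 * x * q^`().[x] ^+ 2).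
Proof.
have -> : energy = horner (q^`() ^+ 2 + n *: q ^+ 2).
  by apply/funext => y; rewrite /energy !hornerE.
apply: is_derive_eq.
rewrite !expr2 derivD derivZ !derivM q_ode.
by rewrite !(hornerM, hornerD, hornerZ, hornerN, hornerX); ring.
Qed.

Lemma energy_ge x : n <= energy x.
Proof.
rewrite -{1}(q_energy0).
apply: (is_derive_ge_at0 x energy_derive) => y.
by rewrite mulrA mulr_ge0 ?sqr_ge0// mulrCA mulr_ge0// -expr2 sqr_ge0.
Qed.

(* [E' <= 2 x E] for [x >= 0], hence [E(x) <= e^(x^2) E(0)]. *)
Lemma energy_le x : energy x <= expR (x ^+ 2) * n.
Proof.
have D y : is_derive y (1 : R) (fun z => expR (- z ^+ 2)) (- (2 * y) * expR (- y ^+ 2)).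
  have D' : is_derive y (1:R) (fun z : R => - z ^+ 2) (- (2 * y)).
    have -> : (fun z : R => - z ^+ 2) = horner (- 'X^2).
      by apply/funext => z; rewrite !hornerE.
    by apply: is_derive_eq; rewrite derivN derivXn !hornerE /=; ring.
  by rewrite mulrC; exact: (is_derive1_comp (f := expR)).
have DN y : is_derive y (1 : R) (fun z => - energy z) (- (2 * y * q^`().[y] ^+ 2)).
  exact: is_deriveN (energy_derive y).
(* The derivative of [- E e^(-x^2)] is [2 n x q^2 e^(-x^2)], which has the sign of [x]; one argument
   thus covers both sides of 0. *)
have H : - energy 0 * expR (- 0 ^+ 2) <= - energy x * expR (- x ^+ 2).
  apply: (is_derive_ge_at0 x (fun y => is_derive_mul (DN y) (D y))) => y.
  rewrite [X in 0 <= X](_ : _ =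
    2 * expR (- y ^+ 2) * n * (y * q.[y]) ^+ 2); last first.
    by rewrite /energy /=; ring.
  by rewrite mulr_ge0 ?sqr_ge0// !mulr_ge0 ?expR_ge0 ?(ltW n_gt0).
move: H; rewrite expr0n /= oppr0 expR0 mulr1 mulNr lerN2.
rewrite expRN ler_pdivrMr ?expR_gt0// mulrC.
by rewrite {2}/energy q_energy0.
Qed.

Lemma energy_sqr_le x : `|x| <= 1 -> q.[x] ^+ 2 <= expR 1.
Proof.
move=> x1; have := energy_le x.
have : expR (x ^+ 2) <= expR 1 by rewrite ler_expR -real_normK ?num_real// expr_le1.
move=> /(ler_wpM2r (ltW n_gt0)) h1 /le_trans/(_ h1).
rewrite /energy [expR 1 * n]mulrC => h.
rewrite -(ler_pM2l n_gt0); apply: le_trans h.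
by rewrite lerDr sqr_ge0.
Qed.

Lemma energy_deriv_sqr_le x : `|x| <= 1 -> q^`().[x] ^+ 2 <= expR 1 * n.
Proof.
move=> x1; have := energy_le x.
have : expR (x ^+ 2) <= expR 1 by rewrite ler_expR -real_normK ?num_real// expr_le1.
move=> /(ler_wpM2r (ltW n_gt0)) h1 /le_trans/(_ h1).
by apply: le_trans; rewrite lerDl mulr_ge0 ?(ltW n_gt0)// sqr_ge0.
Qed.

End Energy.

(** * Growth in [n] of derivatives on [[-1, 1]] *)

Section DerivativeGrowth.
Variable R : realType.
Implicit Types (x : R) (F G : nat -> {poly R}).

(* Each derivative costs a factor [sqrt n], [n = t.+1], uniformly on [-1, 1]. *)
Definition deriv_growth (s : nat) F : Prop :=
  forall i, exists c : R, 0 <= c /\ forall t x, `|x| <= 1 ->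
    `|(F t)^`(i).[x]| <= c * Num.sqrt t.+1%:R ^+ (s + i).

Lemma sqrt_nat_ge1 t : 1 <= Num.sqrt t.+1%:R :> R.
Proof. by rewrite -[leLHS]sqrtr1 ler_sqrt ?ler1n. Qed.

Lemma le_exp_sqrt_nat t (i j : nat) : (i <= j)%N ->
  Num.sqrt t.+1%:R ^+ i <= Num.sqrt t.+1%:R ^+ j :> R.
Proof. by move=> ij; rewrite ler_weXn2l ?sqrt_nat_ge1. Qed.

Lemma deriv_growthW s s' F : (s <= s')%N -> deriv_growth s F -> deriv_growth s' F.
Proof.
move=> ss' gF i; have [c [c0 Fc]] := gF i; exists c; split=> // t x /Fc/le_trans; apply.
by rewrite ler_wpM2l// le_exp_sqrt_nat// leq_add2r.
Qed.

Lemma deriv_growth_cst (p : {poly R}) : deriv_growth 0 (fun=> p).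
Proof.
move=> i; exists (\sum_(j < size p^`(i)) `|p^`(i)`_j|); split.
  by rewrite sumr_ge0.
move=> t x x1; rewrite horner_coef; apply: le_trans (ler_norm_sum _ _ _) _.
rewrite -[leLHS]mulr1 ler_pM ?sumr_ge0// ?exprn_ege1 ?sqrt_nat_ge1//.
apply: ler_sum => j _; rewrite normrM normrX ler_piMr//.
by rewrite exprn_ile1.
Qed.

Lemma deriv_growthD s F G : deriv_growth s F -> deriv_growth s G ->
  deriv_growth s (fun t => F t + G t).
Proof.
move=> gF gG i; have [c [c0 Fc]] := gF i; have [d [d0 Gd]] := gG i.
exists (c + d); split=> [|t x x1]; first exact: addr_ge0.
rewrite derivnD hornerD mulrDl; apply: le_trans (ler_normD _ _) _.
by apply: lerD; [exact: Fc|exact: Gd].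
Qed.

Lemma deriv_growth_deriv s F :
  deriv_growth s F -> deriv_growth s.+1 (fun t => (F t)^`()).
Proof.
move=> gF i; have [c [c0 Fc]] := gF i.+1; exists c; split=> // t x x1.
by rewrite -derivSn addSnnS Fc.
Qed.

(** The Leibniz rule is peeled off one derivative at a time: [(F G)' = F' G + F G'], and
    differentiating either factor raises its own exponent by one. Hence the induction lets both
    factors and exponents vary. *)
Lemma deriv_growthM s s' F G : deriv_growth s F -> deriv_growth s' G ->
  deriv_growth (s + s') (fun t => F t * G t).
Proof.
move=> gF gG i; elim: i s s' F G gF gG => [|i IH] s s' F G gF gG.
  have [c [c0 Fc]] := gF 0; have [d [d0 Gd]] := gG 0.
  exists (c * d); split=> [|t x x1]; first exact: mulr_ge0.
  rewrite derivn0 hornerM normrM addn0 exprD mulrACA ler_pM//.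
    by have := Fc t x x1; rewrite derivn0 addn0.
  by have := Gd t x x1; rewrite derivn0 addn0.
have [c [c0 Fc]] := IH _ _ _ _ (deriv_growth_deriv gF) gG.
have [d [d0 Gd]] := IH _ _ _ _ gF (deriv_growth_deriv gG).
exists (c + d); split=> [|t x x1]; first exact: addr_ge0.
rewrite derivSn derivM derivnD hornerD mulrDl.
apply: le_trans (ler_normD _ _) _; apply: lerD.
  by rewrite addnS -addSn -addSn Fc.
by rewrite addnS -addSn -addnS Gd.
Qed.

(** Each differentiation of the product with ['X] releases one extra copy of the derivative, which
    lowers the constant [a] by one. *)
Lemma derivn_ode (q : {poly R}) (a : R) i : q^`()^`() = 'X * q^`() - a *: q ->
  q^`(i.+2) = 'X * q^`(i.+1) - (a - i%:R) *: q^`(i).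
Proof.
move=> ode; elim: i => [|i IH].
  by rewrite subr0 derivn0 derivn1 -ode.
rewrite derivnS {1}IH derivB derivM derivX mul1r derivZ -!derivnS.
rewrite addrAC addrC; congr (_ + _).
by rewrite -{1}[q^`(i.+1)]scale1r -scalerBl -scaleNr -natr1; congr (_ *: _); ring.
Qed.

Lemma deriv_growth_he_unit : deriv_growth 0 (he_unit R).
Proof.
(* The equation is of second order, so the induction carries the bounds for two consecutive
   derivatives; the energy bound starts it with constant [sqrt e]. *)
suff H i : exists c : R, 0 <= c /\ forall t x, `|x| <= 1 ->
    (`|(he_unit R t)^`(i).[x]| <= c * Num.sqrt t.+1%:R ^+ i) /\
    (`|(he_unit R t)^`(i.+1).[x]| <= c * Num.sqrt t.+1%:R ^+ i.+1).
  by move=> i; have [c [c0 Hc]] := H i; exists c; split=> // t x x1; have [] := Hc t x x1.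
have n0 t : 0 < t.+1%:R :> R by rewrite ltr0n.
elim: i => [|i [c [c0 IH]]].
  exists (Num.sqrt (expR 1)); split=> // t x x1.
  have ode := he_unit_ode R t; have e0 := he_unit_energy0 R t.
  rewrite derivn0 derivn1 expr0 expr1 mulr1 -!sqrtr_sqr -sqrtrM ?expR_ge0//.
  split; rewrite ler_wsqrtr//.
    exact: energy_sqr_le ode e0 _ x1.
  exact: energy_deriv_sqr_le ode e0 _ x1.
(* One unit pays for [x q^(i+1)] with [|x| <= 1], and [1 + i] pays for the coefficient, since
   [|n - i| <= (1 + i) n]. *)
exists (c * (2 + i%:R)); split=> [|t x x1]; first by rewrite mulr_ge0// addr_ge0.
have [IH1 IH2] := IH t x x1; split.
  apply: le_trans IH2 _; rewrite ler_wpM2r ?exprn_ge0//.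
  by rewrite ler_peMr// (le_trans (y := 2)) ?ler1n// lerDl.
rewrite (derivn_ode i (he_unit_ode R t)) hornerD hornerN hornerZ hornerM hornerX.
apply: le_trans (ler_normB _ _) _.
rewrite !normrM.
pose r : R := Num.sqrt t.+1%:R; rewrite -!/r in IH1 IH2 *.
have r1 : 1 <= r by exact: sqrt_nat_ge1.
have rr : t.+1%:R = r ^+ 2 by rewrite sqr_sqrtr.
rewrite [leRHS](_ : _ = c * r ^+ i.+2 + (1 + i%:R) * r ^+ 2 * (c * r ^+ i)); last first.
  by rewrite -[in i.+2]addn2 exprD; ring.
apply: lerD.
  apply: le_trans (_ : 1 * (c * r ^+ i.+1) <= _); first by rewrite ler_pM.
  by rewrite mul1r ler_wpM2l// le_exp_sqrt_nat.
apply: ler_pM => //.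
apply: le_trans (ler_normB _ _) _; rewrite !ger0_norm// rr mulrDl mul1r lerD2l.
by rewrite ler_peMr// exprn_ege1.
Qed.

End DerivativeGrowth.

(** * The truncated bump and the derivatives of the fooling function *)

Section Bump.
Variable R : realType.
Implicit Types (x : R) (k : nat) (p : {poly R}).

Lemma is_derive_posX k x :
  is_derive x 1 (fun y : R => Num.max 0 y ^+ k.+2) (k.+2%:R * Num.max 0 x ^+ k.+1).
Proof.
have [x0|x0|->] := ltgtP x 0.
- apply: (@near_eq_is_derive R R R (cst 0)).
    by near=> y; rewrite max_l ?expr0n//; apply/ltW; near: y; exact: lt_nbhsl.
  by rewrite expr0n mulr0; exact: is_derive_cst.
- apply: (@near_eq_is_derive R R R (fun y => y ^+ k.+2)).
    near=> y; rewrite max_r//.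
    by apply/ltW; near: y; exact: lt_nbhsr.
  have -> : (fun y : R => y ^+ k.+2) = horner 'X^(k.+2).
    by apply/funext => y; rewrite hornerXn.
  by apply: is_derive_eq; rewrite derivXn hornerMn hornerXn mulr_natl.
- rewrite expr0n mulr0.
  (* At the kink the exponent is at least two, so the difference quotient is at most [|h|] in
     absolute value once [|h| < 1]. *)
  have C : h^-1 *: ((fun y : R => Num.max 0 y ^+ k.+2) (h *: (1:R) + 0) -
      (fun y : R => Num.max 0 y ^+ k.+2) 0) @[h --> (0:R)^'] --> (0:R).
    apply/cvgr0Pnorm_lt => e e0; near=> h.
    have h0 : h != 0 by near: h; exact: nbhs_dnbhs_neq.
    have hmin : `|h| < Num.min e 1.
      near: h; apply: dnbhs0_lt; by rewrite lt_min e0 ltr01.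
    move: hmin; rewrite lt_min => /andP[he h1].
    rewrite maxxx expr0n subr0 addr0 /GRing.scale /= mulr1.
    have mh : `|Num.max 0 h| <= `|h|.
      by case: (leP 0 h) => _; rewrite ?normr0.
    apply: le_lt_trans he; rewrite normrM normfV normrX.
    rewrite ler_pdivrMl ?normr_gt0// -expr2.
    apply: le_trans (_ : `|h| ^+ k.+2 <= _); first by rewrite lerXn2r ?nnegrE.
    by rewrite ler_wiXn2l// ltW.
  apply: DeriveDef; first exact: cvgP C.
  exact: cvg_lim C.
Unshelve. all: by end_near. Qed.

Definition bump x : R := Num.max 0 (1 - x ^+ 2).

Lemma bump_ge0 x : 0 <= bump x.
Proof. by rewrite le_max lexx. Qed.

Lemma bump_le1 x : bump x <= 1.
Proof. by rewrite ge_max ler01 gerBl sqr_ge0. Qed.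

Lemma bump_eq0 x : 1 <= `|x| -> bump x = 0.
Proof.
move=> x1; rewrite /bump max_l// subr_le0 -real_normK ?num_real//.
by rewrite exprn_ege1.
Qed.

Lemma bump_gt0 x : `|x| < 1 -> 0 < bump x.
Proof.
move=> x1; rewrite lt_max subr_gt0 -real_normK ?num_real//.
by rewrite expr_lt1 ?x1 ?orbT.
Qed.

(** Where [1 - x^2] is not positive, the remaining power on the right is still at least one, so both
    sides vanish. This lets the product rule factor out a common power of the bump. *)
Lemma bumpX_mul k x : bump x ^+ k.+2 = (1 - x ^+ 2) * bump x ^+ k.+1.
Proof.
rewrite exprS /bump; case: (leP (1 - x ^+ 2) 0) => // h.
by rewrite expr0n /= !mulr0.
Qed.

Lemma is_derive_bumpX k x :
  is_derive x 1 (fun y : R => bump y ^+ k.+2) (- (2 * k.+2%:R * x) * bump x ^+ k.+1).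
Proof.
have D : is_derive x (1:R) (fun y : R => 1 - y ^+ 2) (- (2 * x)).
  have -> : (fun z : R => 1 - z ^+ 2) = horner (1 - 'X^2).
    by apply/funext => z; rewrite !hornerE.
  by apply: is_derive_eq; rewrite derivB derivXn -polyC1 derivC !hornerE /=; ring.
rewrite (_ : _ * _ = (k.+2%:R * Num.max 0 (1 - x ^+ 2) ^+ k.+1) * - (2 * x)).
  exact: (is_derive1_comp (is_derive_posX k _) D).
by rewrite /bump; ring.
Qed.

(* [(p b^k)' = bump_deriv k p * b^(k-1)], where [b] is the bump. *)
Definition bump_deriv k p : {poly R} :=
  (1 - 'X^2) * p^`() + (- (2 * k%:R)) *: ('X * p).

Lemma is_derive_poly_bumpX p k x :
  is_derive x 1 (fun y : R => p.[y] * bump y ^+ k.+2)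
    ((bump_deriv k.+2 p).[x] * bump x ^+ k.+1).
Proof.
apply: is_derive_eq (is_derive_mul (is_derive_poly p x) (is_derive_bumpX k x)) _.
rewrite bumpX_mul /bump_deriv.
by rewrite !(hornerD, hornerM, hornerZ, hornerX, hornerXn, hornerN, hornerC); ring.
Qed.

(** This is the polynomial factor left in the [i]-th derivative of [q^2 b^m] after taking out
    [b^(m-i)]; every differentiation uses up one power of [b]. *)
Fixpoint fool_poly (m t i : nat) : {poly R} :=
  if i is j.+1 then bump_deriv (m - j) (fool_poly m t j) else he_unit R t ^+ 2.

Definition fool (m t i : nat) x : R := (fool_poly m t i).[x] * bump x ^+ (m - i).

(** The hypothesis keeps the exponent [m - i] at least two, so that the power of the bump is
    differentiable across the endpoints. *)
Lemma is_derive_fool m t i x : (i.+2 <= m)%N ->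
  is_derive x 1 (fool m t i) (fool m t i.+1 x).
Proof.
move=> im; rewrite /fool /=; have -> : (m - i = (m - i.+2).+2)%N by lia.
rewrite (_ : m - i.+1 = (m - i.+2).+1)%N; last by lia.
exact: is_derive_poly_bumpX.
Qed.

Lemma fool_poly_growth m i : deriv_growth i (fun t => fool_poly m t i).
Proof.
elim: i => [|i IH] /=.
  by apply: (@deriv_growthM _ 0 0); exact: deriv_growth_he_unit.
apply: deriv_growthD.
  by apply: (deriv_growthM (deriv_growth_cst _) (deriv_growth_deriv IH)).
(* The term from differentiating the bump has no new derivative of [q], so its growth exponent [i]
   is merely relaxed to [i.+1]. *)
apply: (deriv_growthW (leqnSn i)).
rewrite (_ : (fun _ => _) = (fun t => (- (2 * (m - i)%:R)) *: 'X * fool_poly m t i)).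
  by apply: (@deriv_growthM _ 0) => //; exact: deriv_growth_cst.
by apply/funext => t; rewrite -scalerAl.
Qed.

Lemma fool_bound m i : exists c : R, 0 <= c /\ forall t x, `|x| <= 1 ->
  `|fool m t i x| <= c * Num.sqrt t.+1%:R ^+ i.
Proof.
have [c [c0 H]] := fool_poly_growth m i 0; exists c; split=> // t x x1.
rewrite normrM; have := H t x x1; rewrite derivn0 addn0 => h.
rewrite -[leRHS]mulr1 ler_pM// ger0_norm ?exprn_ge0 ?bump_ge0//.
by rewrite exprn_ile1 ?bump_ge0 ?bump_le1.
Qed.

End Bump.

(** * Integration of continuous functions over [[-1, 1]] *)

Section Integral11.
Variable R : realType.
Implicit Types (x r : R) (f g F : R -> R).
Local Notation mu := (@lebesgue_measure R).

Definition int11 f : R := Rintegral mu `[-1, 1]%classic f.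

Lemma integrable11 f : continuous f -> mu.-integrable `[-1, 1]%classic (EFin \o f).
Proof.
move=> cf; apply: continuous_compact_integrable; first exact: segment_compact.
exact: continuous_subspaceT.
Qed.

Lemma integral11_lty f : continuous f ->
  (\int[mu]_(x in `[(-1)%R, 1%R]) (f x)%:E < +oo)%E.
Proof. by move=> cf; apply: integrable_lty => //; exact: integrable11. Qed.

Lemma restrict11 f : (forall x, 1 <= `|x| -> f x = 0) -> f \_ `[-1, 1] = f.
Proof.
move=> f0; apply/funext => x; rewrite patchE; case: ifPn => // /negP xD.
rewrite f0// leNgt; apply/negP => x1; apply: xD; rewrite inE /= in_itv /=.
by move: x1; rewrite ltr_norml => /andP[/ltW -> /ltW ->].
Qed.

Lemma RintegralT_int11 f : (forall x, 1 <= `|x| -> f x = 0) ->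
  Rintegral mu setT f = int11 f.
Proof. by move=> f0; rewrite /int11 [RHS]Rintegral_mkcond restrict11. Qed.

Lemma integralT_lty f : continuous f -> (forall x, 1 <= `|x| -> f x = 0) ->
  (\int[mu]_x (f x)%:E < +oo)%E.
Proof.
move=> cf f0; have := integral11_lty cf.
rewrite integral_mkcond; under eq_integral do rewrite restrict_EFin.
by rewrite restrict11.
Qed.

Lemma int11D f g : continuous f -> continuous g ->
  int11 (fun x => f x + g x) = int11 f + int11 g.
Proof. by move=> cf cg; rewrite /int11 RintegralD//; exact: integrable11. Qed.

Lemma int11Z r f : continuous f -> int11 (fun x => r * f x) = r * int11 f.
Proof. by move=> cf; rewrite /int11 RintegralZl//; exact: integrable11. Qed.

Lemma int11_cst r : int11 (fun=> r) = r * 2.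
Proof.
rewrite /int11 Rintegral_cst//= lebesgue_measure_itv /= lte_fin.
by rewrite (_ : -1 < 1)//= ?opprK.
Qed.

Lemma le_int11 f g : continuous f -> continuous g ->
  (forall x, `|x| <= 1 -> f x <= g x) -> int11 f <= int11 g.
Proof.
move=> cf cg fg; apply: le_Rintegral => //; [exact: integrable11..|].
by move=> x /=; rewrite in_itv /= => h; apply: fg; rewrite ler_norml.
Qed.

Lemma int11_derive f F : continuous f -> (forall x, is_derive x 1 F (f x)) ->
  int11 f = F 1 - F (-1).
Proof.
move=> cf dF; have cF := is_derive_continuous dF.
rewrite /int11 /Rintegral (@continuous_FTC2 _ f F)//.
- exact: continuous_subspaceT.
- split.
  + by move=> x _; have [] := dF x.
  + exact/cvg_at_right_filter/cF.
  + exact/cvg_at_left_filter/cF.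
- by move=> x _; rewrite derive1E; have [_ ->] := dF x.
Qed.

(** By continuity [f] exceeds half its value at [x] on a small interval around [x] inside [[-1, 1]],
    and that interval alone contributes a positive amount. *)
Lemma int11_gt0 f x : continuous f -> (forall y, 0 <= f y) ->
  `|x| < 1 -> 0 < f x -> 0 < int11 f.
Proof.
move=> cf f0 x1 fx.
have [d /= d0 fd] : \forall y \near x, f x / 2 < f y.
  by apply: (cvgr_gt (f x) (cf x)); rewrite ltr_pdivrMr// ltr_pMr// ltr1n.
(* Halving [d] keeps the closed interval inside the open ball of continuity; the second bound keeps
   it inside [[-1, 1]]. *)
pose e := Num.min (d / 2) (1 - `|x|).
have e0 : 0 < e by rewrite lt_min divr_gt0//= subr_gt0.
have ed : e < d by rewrite gt_min ltr_pdivrMr// ltr_pMr// ltr1n.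
have e1 : `|x| + e <= 1 by rewrite -lerBrDl ge_min lexx orbT.
have sub : `[x - e, x + e] `<=` `[-1, 1].
  move=> y /=; rewrite !in_itv /= => yx; rewrite -ler_norml.
  apply: le_trans e1; rewrite -lerBlDl; apply: le_trans (lerB_dist _ _) _.
  by rewrite ler_distl.
apply: fine_gt0; rewrite (integral11_lty cf) andbT.
have le1 : (\int[mu]_(y in `[(x - e)%R, (x + e)%R]) (f y)%:E <=
            \int[mu]_(y in `[(-1)%R, 1%R]) (f y)%:E)%E.
  apply: ge0_subset_integral => //.
  - by case/integrableP : (integrable11 cf).
  - by move=> y _; rewrite lee_fin.
apply: lt_le_trans le1.
apply: lt_le_trans (_ : (\int[mu]_(y in `[(x - e)%R, (x + e)%R]) (cst (f x / 2)%:E y) <= _)%E).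
  rewrite integral_cst//= lebesgue_measure_itv /= lte_fin ler_ltD ?gtrN//.
  by rewrite -EFinB -EFinM lte_fin mulr_gt0 ?divr_gt0// subr_gt0 ler_ltD ?gtrN.
apply: ge0_le_integral => //=.
- by move=> y _; rewrite lee_fin divr_ge0.
- apply: measurable_funS sub _ => //.
  by case/integrableP : (integrable11 cf).
- move=> y; rewrite in_itv /= => yx; rewrite lee_fin ltW//; apply: fd => /=.
  by rewrite distrC (le_lt_trans _ ed)// ler_distl.
Qed.

End Integral11.

(** * The fooling function: weak derivatives, Sobolev norm, integral *)

Section Fooling.
Variable R : realType.
Implicit Types (x r : R) (f g F : R -> R) (t i k : nat).
Local Notation mu := (@lebesgue_measure R).

Lemma continuous_mul f g : continuous f -> continuous g ->
  continuous (fun x => f x * g x).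
Proof. by move=> cf cg x; exact: continuousM (cf x) (cg x). Qed.

Lemma continuous_add f g : continuous f -> continuous g ->
  continuous (fun x => f x + g x).
Proof. by move=> cf cg x; exact: continuousD (cf x) (cg x). Qed.

Lemma continuous_cst r : continuous (fun _ : R => r).
Proof. by move=> x; exact: cvg_cst. Qed.

Definition gauss x : R := expR (- (x ^+ 2) / 2).

Lemma gauss_gt0 x : 0 < gauss x. Proof. exact: expR_gt0. Qed.

Lemma gauss_le1 x : gauss x <= 1.
Proof. by rewrite -expR0 ler_expR mulNr oppr_le0 divr_ge0 ?sqr_ge0. Qed.

Lemma continuous_gauss : continuous gauss.
Proof. exact: is_derive_continuous (@is_derive_gauss R). Qed.

Lemma continuous_bumpX k : continuous (fun x => bump x ^+ k.+2).
Proof. exact: is_derive_continuous (is_derive_bumpX k). Qed.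

Lemma sqrt2pi_gt0 : 0 < Num.sqrt (2 * pi) :> R.
Proof. by rewrite sqrtr_gt0 mulr_gt0 ?pi_gt0. Qed.

Lemma rho_gt0 x : 0 < rho x.
Proof. by rewrite divr_gt0 ?sqrt2pi_gt0// expR_gt0. Qed.

Lemma rho_le x : rho x <= (Num.sqrt (2 * pi))^-1.
Proof. by rewrite ler_piMl ?invr_ge0 ?(ltW sqrt2pi_gt0)// gauss_le1. Qed.

Lemma continuous_rho : continuous (@rho R).
Proof. exact: continuous_mul continuous_gauss (@continuous_cst _). Qed.

Lemma continuous_fool m t i : (i.+2 <= m)%N -> continuous (@fool R m t i).
Proof. by move=> im; apply: is_derive_continuous => x; exact: is_derive_fool. Qed.

Lemma fool_eq0 m t i x : (i < m)%N -> 1 <= `|x| -> @fool R m t i x = 0.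
Proof. by move=> im x1; rewrite /fool bump_eq0// expr0n subn_eq0 leqNgt im mulr0. Qed.

Lemma test_fun_is_derive (phi : R -> R) k x : test_fun phi ->
  is_derive x 1 (derive1n k phi) (derive1n k.+1 phi x).
Proof.
by move=> [H _]; rewrite derive1nS derive1E; exact/derivableP.
Qed.

Lemma test_fun_continuous (phi : R -> R) k : test_fun phi ->
  continuous (derive1n k phi).
Proof. by move=> H; apply: is_derive_continuous => x; exact: test_fun_is_derive. Qed.

(** Boundary terms vanish because of the bump at -1 and 1, whatever the support of [phi]. The bound
    on [i] makes the next derivative continuous as well. *)
Lemma int11_fool_by_parts m t (phi : R -> R) i k : test_fun phi ->
  (i.+3 <= m)%N ->
  int11 (fun x => @fool R m t i x * derive1n k.+1 phi x) =
  - int11 (fun x => @fool R m t i.+1 x * derive1n k phi x).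
Proof.
move=> tphi im; apply/eqP; rewrite -addr_eq0 addrC.
have c1 := @continuous_mul _ _ (@continuous_fool m t i.+1 im)
  (@test_fun_continuous phi k tphi).
have c2 := @continuous_mul _ _ (@continuous_fool m t i (ltnW im))
  (@test_fun_continuous phi k.+1 tphi).
have dF x : is_derive x 1 (fun x => @fool R m t i x * derive1n k phi x)
    (@fool R m t i.+1 x * derive1n k phi x + @fool R m t i x * derive1n k.+1 phi x).
  apply: is_derive_mul; first exact: is_derive_fool (ltnW im).
  exact: test_fun_is_derive.
rewrite -int11D// (int11_derive (continuous_add c1 c2) dF).
have im' : (i < m)%N by apply: leq_trans im; rewrite ltnS ltnW.
by rewrite !fool_eq0 ?normrN ?normr1// !mul0r subrr.
Qed.

Lemma int11_fool_by_partsn m t (phi : R -> R) i j k : test_fun phi ->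
  (i + j + 2 <= m)%N ->
  int11 (fun x => @fool R m t i x * derive1n (j + k) phi x) =
  (-1) ^+ j * int11 (fun x => @fool R m t (i + j) x * derive1n k phi x).
Proof.
move=> tphi; elim: j i => [|j IH] i im; first by rewrite addn0 expr0 mul1r.
rewrite addSn int11_fool_by_parts//; last by apply: leq_trans im; lia.
by rewrite IH ?addSnnS// exprS mulN1r mulNr.
Qed.

Lemma weak_deriv_fool m t i : (i.+2 <= m)%N ->
  weak_deriv i (@fool R m t 0) (@fool R m t i).
Proof.
move=> im phi tphi.
rewrite !RintegralT_int11.
- by have := @int11_fool_by_partsn m t phi 0 i 0 tphi; rewrite addn0 add0n addn2; apply.
- by move=> x x1; rewrite fool_eq0 ?mul0r//; lia.
- by move=> x x1; rewrite fool_eq0 ?mul0r//; lia.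
Qed.

Lemma L2rho_sq_fool m t i : (i.+2 <= m)%N ->
  L2rho_sq (@fool R m t i) = int11 (fun x => @fool R m t i x ^+ 2 * rho x).
Proof.
move=> im; rewrite -RintegralT_int11// => x x1.
by rewrite fool_eq0 ?expr0n ?mul0r//; lia.
Qed.

Lemma continuous_fool_sqr_rho m t i : (i.+2 <= m)%N ->
  continuous (fun x => @fool R m t i x ^+ 2 * rho x).
Proof.
move=> im; apply: continuous_mul; last exact: continuous_rho.
by apply: continuous_mul; exact: continuous_fool.
Qed.

Lemma in_L2rho_fool m t i : (i.+2 <= m)%N -> in_L2rho (@fool R m t i).
Proof.
move=> im; split; first by apply: continuous_measurable_fun; exact: continuous_fool.
apply: integralT_lty; first exact: continuous_fool_sqr_rho.
by move=> x x1; rewrite fool_eq0 ?expr0n ?mul0r//; lia.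
Qed.

Lemma sobolev_witness_fool alpha m t : (alpha.+2 <= m)%N ->
  sobolev_witness alpha (@fool R m t 0) (@fool R m t).
Proof.
move=> am; split=> //; split=> [i ia|i /andP[_ ia]].
  by apply: in_L2rho_fool; apply: leq_trans am.
by apply: weak_deriv_fool; apply: leq_trans am.
Qed.

Lemma L2rho_sq_fool_le m i : (i.+2 <= m)%N -> exists c : R, 0 <= c /\
  forall t, L2rho_sq (@fool R m t i) <= c * (Num.sqrt t.+1%:R ^+ i) ^+ 2.
Proof.
move=> im; have [c [c0 H]] := fool_bound R m i.
pose K : R := (Num.sqrt (2 * pi))^-1.
have K0 : 0 <= K by rewrite invr_ge0 ltW ?sqrt2pi_gt0.
(* The factors are the squared uniform bound, the maximum [K] of the density, and the length 2 of
   the interval. *)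
exists (c ^+ 2 * K * 2); split=> [|t]; first by rewrite !mulr_ge0// sqr_ge0.
rewrite L2rho_sq_fool//.
apply: le_trans (_ : int11 (fun=> (c * Num.sqrt t.+1%:R ^+ i) ^+ 2 * K) <= _).
  apply: le_int11 => [| |x x1]; [exact: continuous_fool_sqr_rho|exact: continuous_cst|].
  apply: ler_pM; rewrite ?sqr_ge0 ?(ltW (rho_gt0 _)) ?rho_le//.
  rewrite -real_normK ?num_real// lerXn2r ?nnegrE ?H// mulr_ge0// exprn_ge0//.
by rewrite int11_cst exprMn le_eqVlt; apply/orP; left; apply/eqP; ring.
Qed.

Lemma sobolev_norm_fool_le alpha m : (alpha.+2 <= m)%N -> exists C : R, 0 < C /\
  forall t, sobolev_norm alpha (@fool R m t) <= C * Num.sqrt t.+1%:R ^+ alpha.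
Proof.
move=> am.
have /choice[c H] (i : 'I_alpha.+1) : exists c : R, 0 <= c /\
    forall t, L2rho_sq (@fool R m t i) <= c * (Num.sqrt t.+1%:R ^+ i) ^+ 2.
  by apply: L2rho_sq_fool_le; apply: leq_trans am; rewrite !ltnS -ltnS.
(* The added 1 makes [C] strictly positive; all orders share the power [alpha] because
   [sqrt n >= 1]. *)
pose C := 1 + \sum_(i < alpha.+1) c i.
have C0 : 0 < C by rewrite ltr_pwDl// sumr_ge0// => i _; case: (H i).
exists (Num.sqrt C); split=> [|t]; first by rewrite sqrtr_gt0.
have r0 : 0 <= Num.sqrt t.+1%:R ^+ alpha :> R by rewrite exprn_ge0.
rewrite -[X in _ * X]ger0_norm// -sqrtr_sqr -sqrtrM ?(ltW C0)// ler_wsqrtr//.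
apply: le_trans (_ : (\sum_(i < alpha.+1) c i) * (Num.sqrt t.+1%:R ^+ alpha) ^+ 2 <= _).
  rewrite mulr_suml; apply: ler_sum => i _; have [ci Hi] := H i.
  apply: le_trans (Hi t) _; rewrite ler_wpM2l// lerXn2r ?nnegrE ?exprn_ge0//.
  by rewrite le_exp_sqrt_nat// -ltnS.
by rewrite ler_wpM2r ?sqr_ge0// lerDr.
Qed.

(** Vanishing on all of [(-1, 1)] would make both the value and the derivative at 0 zero, against
    the normalised energy there. *)
Lemma he_unit_neq0 t : exists x, `|x| < 1 /\ (he_unit R t).[x] != 0.
Proof.
apply: contrapT => H.
have q0 x : `|x| < 1 -> (he_unit R t).[x] = 0.
  by move=> x1; apply: contrapT => /eqP qx; apply: H; exists x.
have D0 : (he_unit R t)^`().[0] = 0.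
  have D := is_derive_poly (he_unit R t) (0 : R).
  rewrite -(@derive_val _ _ _ _ _ _ _ D) (@near_eq_derive R R R _ (cst 0)) ?derive_cst//.
  near=> x; apply: q0; near: x.
  exact: (@nbhs0_lt R R 1 ltr01).
have := he_unit_energy0 R t; rewrite D0 q0 ?normr0// expr0n /= mulr0 addr0.
by move/esym/eqP; rewrite pnatr_eq0.
Unshelve. all: by end_near. Qed.

Lemma fool0E m t x : @fool R m t 0 x = (he_unit R t).[x] ^+ 2 * bump x ^+ m.
Proof. by rewrite /fool /= subn0 horner_exp. Qed.

Lemma fool0_ge0 m t x : 0 <= @fool R m t 0 x.
Proof. by rewrite fool0E mulr_ge0 ?sqr_ge0// exprn_ge0// bump_ge0. Qed.

Lemma fool0_gt0 m t : exists x, `|x| < 1 /\ 0 < @fool R m t 0 x.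
Proof.
have [x [x1 qx]] := he_unit_neq0 t; exists x; split=> //.
rewrite fool0E; apply: mulr_gt0; first by rewrite exprn_even_gt0.
by rewrite exprn_gt0 ?bump_gt0.
Qed.

Lemma sobolev_norm_fool_gt0 alpha m t : (2 <= m)%N ->
  0 < sobolev_norm alpha (@fool R m t).
Proof.
move=> m2; rewrite sqrtr_gt0 big_ord_recl ltr_pwDl//.
  have [x [x1 fx]] := fool0_gt0 m t.
  rewrite L2rho_sq_fool//; apply: (int11_gt0 (x := x)) => //.
  - exact: continuous_fool_sqr_rho.
  - by move=> y; rewrite mulr_ge0 ?sqr_ge0 ?(ltW (rho_gt0 _)).
  - by rewrite mulr_gt0 ?rho_gt0// exprn_gt0.
rewrite sumr_ge0// => i _; apply: Rintegral_ge0 => x _.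
by rewrite mulr_ge0 ?sqr_ge0 ?(ltW (rho_gt0 _)).
Qed.

Definition fool_mass m t : R := int11 (fun x => @fool R m t 0 x * gauss x).

Lemma fool_mass_gt0 m t : (2 <= m)%N -> 0 < fool_mass m t.
Proof.
move=> m2; have [x [x1 fx]] := fool0_gt0 m t.
apply: (int11_gt0 (x := x)) => //.
- by apply: continuous_mul; [exact: continuous_fool|exact: continuous_gauss].
- by move=> y; rewrite mulr_ge0 ?fool0_ge0 ?(ltW (gauss_gt0 _)).
- by rewrite mulr_gt0 ?gauss_gt0.
Qed.

Lemma Igauss_fool m t : (2 <= m)%N ->
  Igauss (@fool R m t 0) = fool_mass m t / Num.sqrt (2 * pi).
Proof.
move=> m2; rewrite /Igauss RintegralT_int11; last first.
  by move=> x x1; rewrite fool_eq0 ?mul0r//; lia.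
rewrite mulrC -int11Z; last first.
  by apply: continuous_mul; [exact: continuous_fool|exact: continuous_gauss].
by congr int11; apply/funext => x; rewrite /rho /gauss; ring.
Qed.

Lemma QGH_fool m t : QGH t.+1 (@fool R m t 0) = 0.
Proof.
rewrite /QGH fsbig1// => x /= hx.
by rewrite fool0E (hermite_he_unit_eq0 hx) expr0n /= !mul0r.
Qed.

End Fooling.

(** * A lower bound, uniform in [n], for the integral of the fooling function *)

Section MassLowerBound.
Variable R : realType.
Implicit Types (x : R) (t k : nat).

Lemma pos_bounded_below (u : nat -> R) (c : R) N : 0 < c -> (forall t, 0 < u t) ->
  (forall t, (N <= t)%N -> c <= u t) -> exists2 d : R, 0 < d & forall t, d <= u t.
Proof.
move=> c0 u0; elim: N c c0 => [|N IH] c c0 H; first by exists c => // t; exact: H.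
apply: (IH (Num.min c (u N))); first by rewrite lt_min c0 u0.
move=> t; rewrite leq_eqVlt => /predU1P[<-|/H ct]; first by rewrite ge_min lexx orbT.
by rewrite ge_min ct.
Qed.

Lemma he_unit_cross_le t x : `|x| <= 1 ->
  `|(he_unit R t).[x] * (he_unit R t)^`().[x]| <= expR 1 * Num.sqrt t.+1%:R.
Proof.
move=> x1; have n0 : 0 < t.+1%:R :> R by rewrite ltr0n.
have ode := he_unit_ode R t; have e0 := he_unit_energy0 R t.
have a := energy_sqr_le n0 ode e0 x1; have b := energy_deriv_sqr_le n0 ode e0 x1.
have -> : expR 1 * Num.sqrt t.+1%:R = Num.sqrt (expR 1 * (expR 1 * t.+1%:R)) :> R.
  by rewrite mulrA -expr2 sqrtrM ?sqr_ge0// sqrtr_sqr ger0_norm ?expR_ge0.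
by rewrite -sqrtr_sqr ler_wsqrtr// exprMn ler_pM ?sqr_ge0.
Qed.

(* Integrating [(q q' b^m g)' = (q'^2 - n q^2) b^m g + q q' (b^m)' g] shows that
   [q'^2] and [n q^2] carry the same share of the energy up to [O(sqrt n)]. *)
Lemma fool_mass_ge k : exists2 K : R, 0 < K & forall t,
  t.+1%:R * int11 (fun x => bump x ^+ k.+3 * gauss x) <=
  2 * t.+1%:R * fool_mass R k.+3 t + K * Num.sqrt t.+1%:R.
Proof.
(* [2 (k+3)] comes from differentiating [b^(k+3)] and [e] from the bound on [q q']; the later factor
   2 is the length of the interval. *)
pose K : R := 2 * k.+3%:R * expR 1.
have K0 : 0 < K by rewrite !mulr_gt0 ?expR_gt0.
exists (K * 2) => [|t]; first by rewrite mulr_gt0.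
have n0 : 0 < t.+1%:R :> R by rewrite ltr0n.
have ode := he_unit_ode R t; have e0 := he_unit_energy0 R t.
pose n : R := t.+1%:R; pose q := he_unit R t; pose r : R := Num.sqrt n.
rewrite -/n -/r in n0 ode e0 *; rewrite -/q in ode e0.
pose p1 := q^`() ^+ 2 - n *: q ^+ 2; pose p2 := (- (2 * k.+3%:R)) *: ('X * (q * q^`())).
pose dG x := p1.[x] * (bump x ^+ k.+3 * gauss x) + p2.[x] * (bump x ^+ k.+2 * gauss x).
(* The term [x q q'] from the differential equation cancels against the derivative of the
   Gaussian. *)
have dGE x : is_derive x 1 (fun y => (q * q^`()).[y] * bump y ^+ k.+3 * gauss y) (dG x).
  apply: is_derive_eq (is_derive_mul (is_derive_mul (is_derive_poly _ x)
    (is_derive_bumpX k.+1 x)) (is_derive_gauss x)) _.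
  rewrite /dG /p1 /p2 -/(gauss x) derivM ode !expr2.
  by rewrite !(hornerD, hornerM, hornerZ, hornerX, hornerN); ring.
have cw j : continuous (fun x => bump x ^+ j.+2 * gauss x :> R).
  by apply: continuous_mul; [exact: continuous_bumpX|exact: continuous_gauss].
have cG : continuous dG.
  by apply: continuous_add; apply: continuous_mul => //; exact: continuous_horner.
have cf : continuous (fun x => @fool R k.+3 t 0 x * gauss x).
  by apply: continuous_mul; [exact: continuous_fool|exact: continuous_gauss].
have iG : int11 dG = 0.
  rewrite (int11_derive cG dGE) !bump_eq0 ?normrN ?normr1//.
  by rewrite expr0n /= !mulr0 !mul0r subrr.
rewrite -int11Z// /fool_mass -int11Z//.
(* Adding the zero integral of [dG] reduces the claim to a pointwise one: [2 n q^2 + (q'^2 - n q^2)]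
   is the energy, which is at least [n]. *)
rewrite -[X in X + _]addr0 -iG -int11D//; last first.
  by apply: continuous_mul => //; exact: continuous_cst.
have -> : K * 2 * r = int11 (fun=> K * r) by rewrite int11_cst; ring.
have c1 : continuous (fun x => 2 * n * (@fool R k.+3 t 0 x * gauss x)).
  by apply: continuous_mul => //; exact: continuous_cst.
have c2 := continuous_add c1 cG.
rewrite -int11D//; last exact: continuous_cst.
apply: le_int11 => [| |x x1].
- by apply: continuous_mul => //; exact: continuous_cst.
- by apply: continuous_add => //; exact: continuous_cst.
have w0 j : 0 <= bump x ^+ j * gauss x.
  by rewrite mulr_ge0 ?exprn_ge0 ?bump_ge0// ltW ?gauss_gt0.
have w1 j : bump x ^+ j * gauss x <= 1.
  rewrite mulr_ile1 ?exprn_ge0 ?bump_ge0 ?gauss_le1 ?(ltW (gauss_gt0 _))//.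
  by rewrite exprn_ile1 ?bump_ge0 ?bump_le1.
have E := energy_ge ode e0 x; rewrite /energy in E.
have cross : - (K * r) <= p2.[x] * (bump x ^+ k.+2 * gauss x).
  rewrite lerNl; apply: le_trans (ler_norm _) _; rewrite normrN normrM -[leRHS]mulr1.
  apply: ler_pM => //; last by rewrite ger0_norm.
  rewrite /p2 hornerZ hornerM hornerX hornerM 2!normrM normrN.
  rewrite (ger0_norm (mulr_ge0 _ _))// /K -[leRHS]mulrA ler_wpM2l//.
  rewrite -[leRHS]mul1r; apply: ler_pM => //; exact: he_unit_cross_le.
rewrite /dG fool0E /p1 -/q hornerD hornerN (hornerZ n (q ^+ 2)) !horner_exp.
have := ler_wpM2r (w0 k.+3) E.
rewrite -[_ * bump x ^+ _ * gauss x]mulrA.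
by move: (bump x ^+ k.+3 * gauss x) (p2.[x] * _) cross => w z cross Ew; lra.
Qed.

Lemma fool_mass_bounded_below k : exists2 c : R, 0 < c & forall t, c <= fool_mass R k.+3 t.
Proof.
have [K K0 H] := fool_mass_ge k.
set W := int11 _ in H.
have W0 : 0 < W.
  apply: (int11_gt0 (x := 0)).
  - by apply: continuous_mul; [exact: continuous_bumpX|exact: continuous_gauss].
  - by move=> y; rewrite mulr_ge0 ?exprn_ge0 ?bump_ge0// ltW ?gauss_gt0.
  - by rewrite normr0.
  - by rewrite mulr_gt0 ?gauss_gt0// exprn_gt0// bump_gt0 ?normr0.
(* Past this threshold [K sqrt n <= n W / 2], so the inequality [n W <= 2 n M + K sqrt n] for the
   mass [M] leaves [M >= W / 4]. *)
apply: (@pos_bounded_below _ (W / 4) (Num.bound ((2 * K / W) ^+ 2))).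
- by rewrite divr_gt0.
- by move=> t; exact: fool_mass_gt0.
move=> t Nt; have := H t.
have n0 : 0 < t.+1%:R :> R by rewrite ltr0n.
have : (2 * K / W) ^+ 2 <= t.+1%:R.
  apply: le_trans (ltW (archi_boundP (sqr_ge0 _))) _.
  by rewrite ler_nat ltnW.
set n : R := t.+1%:R in n0 *; set r : R := Num.sqrt n.
have r0 : 0 < r by rewrite sqrtr_gt0.
have rn : n = r ^+ 2 by rewrite sqr_sqrtr// ltW.
have s0 : 0 <= 2 * K / W by rewrite divr_ge0 ?mulr_ge0// ltW.
rewrite rn ler_pXn2r ?nnegrE ?(ltW r0)// ler_pdivrMr// => KW HW.
have : K * r <= r ^+ 2 * W / 2.
  rewrite ler_pdivlMr// [leLHS](_ : _ = r * (2 * K)); last by ring.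
  by rewrite expr2 -mulrA ler_wpM2l// ltW.
move=> KW2; rewrite -(ler_pM2l (exprn_gt0 2 r0)); lra.
Qed.

End MassLowerBound.

(** * The worst-case error bound *)

Lemma powR_half_exp (R : realType) (n alpha : nat) :
  (n%:R : R) `^ (- (alpha%:R / 2)) = (Num.sqrt n%:R ^+ alpha)^-1.
Proof.
by rewrite powRN mulrC powRrM powR12_sqrt ?ler0n// powR_mulrn ?sqrtr_ge0.
Qed.

Theorem theorem3p2 (R : realType) (alpha : nat) :
  exists C : R, 0 < C /\
    forall n : nat, (2 <= n)%N ->
      ((C * (n%:R) `^ (- (alpha%:R / 2)))%:E <= ewor alpha (@QGH R n))%E.
Proof.
have [c c0 Hc] := fool_mass_bounded_below R alpha.
have am : (alpha.+2 <= alpha.+3)%N by [].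
have [D [D0 HD]] := sobolev_norm_fool_le R am.
(* [c / sqrt (2 pi)] bounds the integral from below and [D sqrt n ^ alpha] the norm from above;
   below, [n] is [t.+1], matching the indexing of [he_unit]. *)
exists (c / Num.sqrt (2 * pi) / D).
split=> [|[//|t] _]; first by rewrite !divr_gt0// sqrt2pi_gt0.
rewrite powR_half_exp.
pose f := @fool R alpha.+3 t.
have I0 : 0 < Igauss (f 0%N) by rewrite Igauss_fool// divr_gt0 ?sqrt2pi_gt0// fool_mass_gt0.
apply: le_trans (_ : (`|Igauss (f 0%N) - QGH t.+1 (f 0%N)| / sobolev_norm alpha f)%:E <= _)%E.
  rewrite lee_fin QGH_fool subr0 ger0_norm ?(ltW I0)// Igauss_fool//.
  rewrite -mulrA -invfM ler_pM ?invr_ge0//.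
  - by rewrite divr_ge0 ?ltW// sqrt2pi_gt0.
  - by rewrite mulr_ge0 ?exprn_ge0// ltW.
  - by rewrite ler_wpM2r ?Hc// invr_ge0 ltW// sqrt2pi_gt0.
  - by rewrite lef_pV2 ?posrE ?HD ?sobolev_norm_fool_gt0// mulr_gt0// exprn_gt0// sqrtr_gt0.
apply: ereal_sup_ubound; exists (f 0%N), f; split=> //.
- exact: continuous_fool.
(* The fooling function is nonzero because its Gaussian integral is positive. *)
- move=> f0; move: I0; rewrite f0 /Igauss.
  rewrite (_ : (fun x => _) = fun=> 0) ?Rintegral_cst ?mul0r ?ltxx//.
  by apply/funext => x; rewrite mul0r.
- exact: sobolev_witness_fool.
Qed.
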